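(* For integers $0<j\le k$ let $\overline{p}_{k,j}(n)$ be defined by $\sum_{n\ge0}\overline{p}_{k,j}(n)q^n=\prod_{n\ge1}\frac{(1+q^n)^j}{(1-q^n)^k}$. Let $\delta$ be an integer. Then $\overline{p}_{k,j}(\ell n+\delta)\equiv0\pmod\ell$ for all $n\ge0$ if any of the following holds: (1) $\ell\ge5$ prime, $(k+j,-j)\equiv(-1,0)\pmod\ell$ and $\left(\frac{24\delta+1}{\ell}\right)=-1$; (2) $\ell\ge5$ prime, $(k+j,-j)\equiv(0,-1)\pmod\ell$ and $\left(\frac{12\delta+1}{\ell}\right)=-1$; (3) $\ell\ge5$ prime, $(k+j,-j)\equiv(-3,0)\pmod\ell$ and either $\left(\frac{8\delta+1}{\ell}\right)=-1$ or $8\delta+1\equiv0\pmod\ell$; (4) $\ell\ge5$ prime, $(k+j,-j)\equiv(0,-3)\pmod\ell$ and either $\left(\frac{4\delta+1}{\ell}\right)=-1$ or $4\delta+1\equiv0\pmod\ell$; (5) $\ell\ge3$ prime, $(k+j,-j)\equiv(-2,1)\pmod\ell$ and $\left(\frac{\delta}{\ell}\right)=-1$; (6) $\ell\ge3$ prime, $(k+j,-j)\equiv(1,-2)\pmod\ell$ and $\left(\frac{8\delta+1}{\ell}\right)=-1$; (7) $\ell\ge5$ prime, $(k+j,-j)\equiv(-5,2)\pmod\ell$ and either $\left(\frac{24\delta+1}{\ell}\right)=-1$ or $24\delta+1\equiv0\pmod\ell$; (8) $\ell\ge5$ prime, $(k+j,-j)\equiv(2,-5)\pmod\ell$ and either $\left(\frac{3\delta+1}{\ell}\right)=-1$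 or $3\delta+1\equiv0\pmod\ell$.
   Context: $\overline{p}_{k,j}(n)$ counts $(k,j)$-colored overpartitions of $n$: $k$-colored partitions of $n$ in which the first occurrence of any number in $j$ of the colors may be overlined. $\left(\frac{\cdot}{\ell}\right)$ is the Legendre symbol. *)

(* Defs.v *)
From mathcomp Require Import all_boot all_order all_algebra.

Set Implicit Arguments.
Unset Strict Implicit.
Unset Printing Implicit Defensive.

Import GRing.Theory.
Local Open Scope ring_scope.

(* Formal power series in q are handled through their truncations: the
   geometric series 1/(1 - q^n) is cut after its (N+1)-st term. *)
Definition geom_trunc (N n : nat) : {poly int} :=
  \sum_(i < N.+1) 'X^(n * i).

Definition overpart_trunc (k j N : nat) : {poly int} :=
  \prod_(1 <= n < N.+1) ((1 + 'X^n) ^+ j * geom_trunc N n ^+ k).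

(* The coefficient of q^N in the infinite product
   \prod_(n >= 1) (1 + q^n)^j / (1 - q^n)^k: since N is fixed, neither the
   factors with n > N nor the discarded terms q^(n i), i > N, contribute.
   See [overpart_gf] below. *)
Definition overpart_nat (k j N : nat) : int := (overpart_trunc k j N)`_N.

(* The extension by 0 to negative arguments. *)
Definition overpart (k j : nat) (m : int) : int :=
  if m is Posz N then overpart_nat k j N else 0.

Definition legendre (a : int) (l : nat) : int :=
  if (l %| a)%Z then 0
  else if [exists x : 'I_l, ((x%:Z ^+ 2)%R == a %[mod l])%Z] then 1
  else -1.

Section GeneratingFunction.

Let eqX (M : nat) (a b : {poly int}) := exists r, a = b + r * 'X^(M.+1).

Let eqX_refl M a : eqX M a a.
Proof. by exists 0; rewrite mul0r addr0. Qed.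

Let eqX_mul M a b c d : eqX M a b -> eqX M c d -> eqX M (a * c) (b * d).
Proof.
move=> [r ->] [s ->]; exists (b * s + r * d + r * s * 'X^(M.+1)).
rewrite !mulrDl !mulrDr -!addrA -!mulrA.
by congr (_ + (_ + _)); rewrite [_ * d]mulrC; congr (_ + _);
   rewrite ['X^_ * (s * _)]mulrCA.
Qed.

Let eqX_exp M a b e : eqX M a b -> eqX M (a ^+ e) (b ^+ e).
Proof.
move=> ab; elim: e => [|e IH]; first by rewrite !expr0; exact: eqX_refl.
by rewrite !exprS; exact: eqX_mul.
Qed.

Let eqX_prod M (r : seq nat) (F G : nat -> {poly int}) :
  (forall n, n \in r -> eqX M (F n) (G n)) ->
  eqX M (\prod_(n <- r) F n) (\prod_(n <- r) G n).
Proof.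
elim: r => [|x r IH] FG; first by rewrite !big_nil; exact: eqX_refl.
rewrite !big_cons; apply: eqX_mul; first by apply: FG; rewrite mem_head.
by apply: IH => n nr; apply: FG; rewrite in_cons nr orbT.
Qed.

Let eqX_take M a b : eqX M a b <-> take_poly M.+1 a = take_poly M.+1 b.
Proof.
split=> [[r ->]|e]; first by rewrite take_polyD take_polyMXn_0 addr0.
exists (drop_poly M.+1 a - drop_poly M.+1 b).
rewrite -[LHS](poly_take_drop M.+1) e mulrBl.
rewrite -[X in _ = X + _](poly_take_drop M.+1).
by rewrite -addrA; congr (_ + _); rewrite addrC subrK.
Qed.

Let eqX_addXn M a n : (M < n)%N -> eqX M (a + 'X^n) a.
Proof. by move=> Mn; exists 'X^(n - M.+1); rewrite -exprD subnK. Qed.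

Let eqX_subXn M a n : (M < n)%N -> eqX M (a - 'X^n) a.
Proof. by move=> Mn; exists (- 'X^(n - M.+1)); rewrite mulNr -exprD subnK. Qed.

Let geom_truncM N n : (1 - 'X^n) * geom_trunc N n = 1 - 'X^(n * N.+1).
Proof.
have -> : 1 - 'X^(n * N.+1) = 1 ^+ N.+1 - ('X^n) ^+ N.+1 :> {poly int}.
  by rewrite expr1n exprM.
rewrite subrXX; congr (_ * _).
by apply: eq_bigr => i _; rewrite expr1n mul1r exprM.
Qed.

Let geom_trunc_stable M N n : (M <= N)%N -> (0 < n)%N ->
  eqX M (geom_trunc N n) (geom_trunc M n).
Proof.
move=> + n0; elim: N => [|N IH].
  by rewrite leqn0 => /eqP ->; exact: eqX_refl.
rewrite leq_eqVlt => /orP[/eqP<-|MN]; first exact: eqX_refl.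
have /eqX_take e1 := IH MN; apply/eqX_take; rewrite -e1; apply/eqX_take.
rewrite /geom_trunc big_ord_recr /=; apply: eqX_addXn.
exact: leq_trans MN (leq_pmull _ n0).
Qed.

Let geom_trunc_1 M N n : (M < n)%N -> eqX M (geom_trunc N n) 1.
Proof.
move=> Mn; elim: N => [|N IH].
  by rewrite /geom_trunc big_ord1 muln0 expr0; exact: eqX_refl.
apply/eqX_take; move/eqX_take: IH => <-; apply/eqX_take.
rewrite /geom_trunc big_ord_recr /=; apply: eqX_addXn.
exact: leq_trans Mn (leq_pmulr _ _).
Qed.

Let overpart_trunc_stable k j M N : (M <= N)%N ->
  eqX M (overpart_trunc k j N) (overpart_trunc k j M).
Proof.
move=> MN; rewrite /overpart_trunc (big_cat_nat (n := M.+1)) //=.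
rewrite -[X in eqX _ _ X]mulr1; apply: eqX_mul.
  apply: eqX_prod => n; rewrite mem_index_iota => /andP[n0 _].
  by apply: eqX_mul; [exact: eqX_refl|apply: eqX_exp; exact: geom_trunc_stable].
have e1 : \prod_(M.+1 <= n < N.+1) 1 = 1 :> {poly int} by rewrite big1_eq.
rewrite -[X in eqX _ _ X]e1.
apply: eqX_prod => n; rewrite mem_index_iota => /andP[Mn _].
rewrite -[X in eqX _ _ X]mulr1; apply: eqX_mul.
  by rewrite -[X in eqX _ _ X](expr1n _ j); apply: eqX_exp; exact: eqX_addXn.
by rewrite -[X in eqX _ _ X](expr1n _ k); apply: eqX_exp; exact: geom_trunc_1.
Qed.

(* The generating function identity, with denominators cleared, modulo q^(N+1)
   for every N.  It determines [overpart_nat k j] uniquely. *)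
Lemma overpart_gf (k j N : nat) :
  take_poly N.+1 ((\poly_(m < N.+1) overpart_nat k j m)
                  * \prod_(1 <= n < N.+1) (1 - 'X^n) ^+ k)
  = take_poly N.+1 (\prod_(1 <= n < N.+1) (1 + 'X^n) ^+ j).
Proof.
apply/eqX_take.
have e1 : eqX N (\poly_(m < N.+1) overpart_nat k j m) (overpart_trunc k j N).
  apply/eqX_take/polyP => i; rewrite !coef_take_poly coef_poly.
  case: ltnP => // iN; have /eqX_take/(congr1 (fun p : {poly int} => p`_i)) :=
    @overpart_trunc_stable k j i N iN.
  by rewrite !coef_take_poly ltnSn => ->.
apply/eqX_take.
set D := \prod_(1 <= n < N.+1) (1 - 'X^n) ^+ k.
have /eqX_take -> := eqX_mul e1 (eqX_refl N D).
apply/eqX_take; rewrite /overpart_trunc -big_split /=.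
apply: eqX_prod => n; rewrite mem_index_iota => /andP[n0 _].
rewrite -mulrA -exprMn [geom_trunc _ _ * _]mulrC geom_truncM.
rewrite -[X in eqX _ _ X]mulr1; apply: eqX_mul; first exact: eqX_refl.
rewrite -[X in eqX _ _ X](expr1n _ k); apply: eqX_exp; apply: eqX_subXn.
exact: leq_pmull.
Qed.

End GeneratingFunction.

(* Main.v *)
Require Import Defs.
From mathcomp Require Import all_boot all_order all_algebra.
From mathcomp Require Import zify ring.

(* Write f_d for the product of the 1 - q^(d n).  The generating function is
   f_2^j / f_1^(k+j), and modulo l every l-th power is a series in q^l, so it
   equals f_1^a f_2^b times a series in q^l as soon as (k+j, -j) = (-a, -b) mod l.
   In each of the eight cases f_1^a f_2^b is a theta series sum_k w_k q^(e_k)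
   for which A e_k + B is the square of an integer x_k.  A term of index congruent
   to delta thus forces A delta + B to be a square modulo l; if A delta + B
   vanishes modulo l, then l divides x_k, which in these cases divides w_k.

   The theta series come from the Jacobi triple product: directly for f_1,
   f_1^2 / f_2 and f_2^2 / f_1, through a derivative for f_1^3, and for
   f_1^5 / f_2^2 and f_2^5 / f_1^2 by rearranging a double series.  Power series
   identities are stated in an arbitrary commutative ring with q^(M+1) = 0, where
   infinite sums and products become finite ones over large enough ranges. *)

Set Implicit Arguments.
Unset Strict Implicit.
Unset Printing Implicit Defensive.

Import Order.TTheory GRing.Theory Num.Theory.
Local Open Scope ring_scope.

(** * Finite triple product *)

Section FiniteTripleProduct.
Variable R : comNzRingType.
Implicit Types (a b c s : R) (m n j : nat).

Definition qpoch s n : R := \prod_(i < n) (1 - s ^+ i.+1).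

(** The Gaussian binomial coefficient, given by the q-Pascal rule because a quotient of [qpoch]
    values need not make sense in [R]. *)
Fixpoint qbin s n m : R :=
  match n, m with
  | _, 0 => 1
  | 0, _.+1 => 0
  | n'.+1, m'.+1 => qbin s n' m' + s ^+ m'.+1 * qbin s n' m'.+1
  end.

Lemma qbin0 s n : qbin s n 0 = 1. Proof. by case: n. Qed.

Lemma qbin_small s n m : (n < m)%N -> qbin s n m = 0.
Proof.
elim: n m => [|n IH] [|m] //= nm.
by rewrite !IH ?mulr0 ?addr0 //; lia.
Qed.

Lemma qpoch0 s : qpoch s 0 = 1. Proof. exact: big_ord0. Qed.

Lemma qpochS s n : qpoch s n.+1 = qpoch s n * (1 - s ^+ n.+1).
Proof. by rewrite /qpoch big_ord_recr. Qed.

Lemma qbin_qpoch s n m : (m <= n)%N ->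
  qbin s n m * qpoch s m * qpoch s (n - m) = qpoch s n.
Proof.
elim: n m => [|n IH] [|m] //=; rewrite ?subn0 ?qpoch0 ?mul1r //.
rewrite ltnS subSS => mn; rewrite !qpochS.
have e1 := IH _ mn; move: mn; rewrite leq_eqVlt => /orP[/eqP mn|mn].
  subst m; rewrite (@qbin_small s n n.+1) // mulr0 addr0 -[in RHS]e1; ring.
have e2 := IH _ mn; have e3 : (n - m = (n - m.+1).+1)%N by lia.
rewrite e3 !qpochS -e3 in e1 e2 *.
have -> : s ^+ n.+1 = s ^+ m.+1 * s ^+ (n - m).
  by rewrite -exprD; congr (_ ^+ _); lia.
set u := s ^+ m.+1 in e2 *; set v := s ^+ (n - m) in e1 *.
(* The two Pascal terms get the weights 1 - u and u (1 - v), whose sum is 1 - u v = 1 - s^(n+1). *)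
transitivity ((1 - u) * (qbin s n m * qpoch s m * (qpoch s (n - m.+1) * (1 - v)))
  + u * (1 - v) * (qbin s n m.+1 * (qpoch s m * (1 - u)) * qpoch s (n - m.+1))).
  by ring.
by rewrite e1 e2; ring.
Qed.

(* The term of index k = j - n of the triple product; for c = 1 and s = a b it is
   a^(k(k+1)/2) b^(k(k-1)/2).  The extra c avoids dividing by z when b / c = 1 / z. *)
Definition jtp_term a b c s n j : R :=
  if (n <= j)%N then a ^+ (j - n) * s ^+ 'C(j - n, 2) * c ^+ n
  else b ^+ (n - j) * s ^+ 'C(n - j, 2) * c ^+ j.

(** Induction on m: once the factor i = 0 is split off, the rest is the same product for a s, and
    the q-Pascal rule recombines the two sums. *)
Lemma qbinomial_theorem a s m :
  \prod_(i < m) (1 - a * s ^+ i)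
  = \sum_(j < m.+1) (-1) ^+ j * qbin s m j * (a ^+ j * s ^+ 'C(j, 2)).
Proof.
elim: m a => [|m IH] a.
  by rewrite big_ord0 big_ord1 /= !expr0 !mul1r.
rewrite big_ord_recl /= expr0 mulr1.
under eq_bigr => i _ do rewrite /bump /= add1n exprS mulrA.
rewrite IH mulrBl mul1r.
rewrite [RHS]big_ord_recl /=.
under [in RHS]eq_bigr => i _.
  rewrite /bump /= add1n mulrDr mulrDl.
  have -> : (-1) ^+ i.+1 * qbin s m i * (a ^+ i.+1 * s ^+ 'C(i.+1, 2))
    = - (a * ((-1) ^+ i * qbin s m i * ((a * s) ^+ i * s ^+ 'C(i, 2)))).
    by rewrite binS bin1 exprD exprMn !(exprS _ i); ring.
  have -> : (-1) ^+ i.+1 * (s ^+ i.+1 * qbin s m i.+1) * (a ^+ i.+1 * s ^+ 'C(i.+1, 2))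
    = (-1) ^+ i.+1 * qbin s m i.+1 * ((a * s) ^+ i.+1 * s ^+ 'C(i.+1, 2)).
    by rewrite exprMn; ring.
  over.
rewrite big_split /= sumrN -mulr_sumr addrCA addrC; congr (_ + _).
rewrite big_ord_recl /= [in RHS]big_ord_recr /=.
rewrite (@qbin_small s m m.+1) // mulr0 mul0r addr0.
by rewrite !qbin0.
Qed.

Lemma jtp_termS a b c s n j :
  jtp_term a b c s n.+1 j.+1 = c * jtp_term a b c s n j.
Proof. by rewrite /jtp_term ltnS !subSS; case: ifP => _; rewrite exprS; ring. Qed.

Lemma jtp_termM a b c s n j : a * b = s * c ->
  jtp_term a b c s n j * (b * s ^+ n) = s ^+ j * jtp_term a b c s n.+1 j.
Proof.
move=> ab; rewrite /jtp_term; case: (ltngtP n j) => nj.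
- have -> : (j - n = (j - n.+1).+1)%N by lia.
  rewrite binS bin1 exprD.
  have -> : s ^+ j = s ^+ n * s * s ^+ (j - n.+1).
    by rewrite -exprSr -exprD; congr (_ ^+ _); lia.
  have -> : a ^+ (j - n.+1).+1 = a * a ^+ (j - n.+1) by rewrite exprS.
  have -> : c ^+ n.+1 = c * c ^+ n by rewrite exprS.
  transitivity ((a * b) * (a ^+ (j - n.+1) * (s ^+ 'C(j - n.+1, 2) *
    s ^+ (j - n.+1)) * c ^+ n * s ^+ n)); first by ring.
  by rewrite ab; ring.
- have -> : (n.+1 - j = (n - j).+1)%N by lia.
  rewrite binS bin1 exprD.
  have -> : s ^+ n = s ^+ j * s ^+ (n - j) by rewrite -exprD; congr (_ ^+ _); lia.
  by rewrite exprS; ring.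
- by subst j; rewrite subnn subSnn /= !expr0; ring.
Qed.

(** Induction on n from the q-binomial theorem. In the new factor c - b s^n, the part c yields the
    first term of the q-Pascal rule and the part b s^n the second, through [jtp_termM]. *)
Lemma finite_triple_product a b c s m n : a * b = s * c ->
  \prod_(i < m) (1 - a * s ^+ i) * \prod_(i < n) (c - b * s ^+ i)
  = \sum_(j < (m + n).+1) (-1) ^+ (n + j) * qbin s (m + n) j * jtp_term a b c s n j.
Proof.
move=> ab; elim: n => [|n IH].
  rewrite big_ord0 mulr1 addn0 qbinomial_theorem; apply: eq_bigr => i _.
  by rewrite /jtp_term /= subn0 expr0 mulr1 add0n.
rewrite big_ord_recr /= mulrA IH addnS mulrBr.
rewrite [RHS]big_ord_recl /= addn0.
under [in RHS]eq_bigr => i _.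
  rewrite /bump /= add1n mulrDr mulrDl jtp_termS.
  have -> : (-1) ^+ (n.+1 + i.+1) * qbin s (m + n) i * (c * jtp_term a b c s n i)
     = (-1) ^+ (n + i) * qbin s (m + n) i * jtp_term a b c s n i * c.
    by rewrite addSn addnS !exprS; ring.
  have -> : (-1) ^+ (n.+1 + i.+1) * (s ^+ i.+1 * qbin s (m + n) i.+1)
       * (c * jtp_term a b c s n i)
     = - ((-1) ^+ (n + i.+1) * qbin s (m + n) i.+1 * jtp_term a b c s n i.+1
          * (b * s ^+ n)).
    by rewrite -jtp_termS -[in RHS]mulrA jtp_termM // addSn exprS; ring.
  over.
rewrite big_split /= -mulr_suml sumrN addrCA; congr (_ + _).
rewrite mulr_suml big_ord_recl /= [in RHS]big_ord_recr /=.
rewrite (@qbin_small s (m + n) (m + n).+1) //.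
rewrite mulr0 !mul0r addr0 opprD; congr (_ + _).
have := jtp_termM n 0 ab; rewrite expr0 mul1r => <-.
by rewrite qbin0 addn0 exprS; ring.
Qed.

End FiniteTripleProduct.

(** * Sums over integer windows *)

Section IntegerIndices.

(** The triangular number k (k + 1) / 2 for k of either sign; it is never negative, so it can serve
    as an exponent. *)
Definition tri (k : int) : nat := `|((k * (k + 1)) %/ 2)%Z|%N.

Lemma triE k : 2 * (tri k)%:Z = k * (k + 1).
Proof.
have ev : (2 %| k * (k + 1))%Z.
  rewrite dvdzE abszM Euclid_dvdM //=; apply/orP; lia.
rewrite /tri; have := divzK ev; set x := (_ %/ 2)%Z; nia.
Qed.

Lemma tri_nat (n : nat) : tri n = 'C(n.+1, 2).
Proof. have := triE n; have := mul_bin_diag n.+1 1; rewrite bin1; lia. Qed.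

Lemma tri_opp (n : nat) : tri (- n%:Z) = 'C(n, 2).
Proof.
have := triE (- n%:Z); case: n => [|n]; first by rewrite bin0n; lia.
have -> : - n.+1%:Z * (- n.+1%:Z + 1) = n.+1%:Z * n%:Z by rewrite intS; ring.
by have := mul_bin_diag n.+1 1; rewrite bin1; lia.
Qed.

Lemma tri_inv k : tri (- 1 - k) = tri k.
Proof. 
have := triE (- 1 - k); have -> : (- 1 - k) * (- 1 - k + 1) = k * (k + 1) by ring.
by rewrite -triE; lia.
Qed.

Definition zwin n : seq int := [seq i%:Z - n%:Z | i <- iota 0 n.*2.+1].

Lemma zwin_uniq n : uniq (zwin n).
Proof. by rewrite map_inj_uniq ?iota_uniq // => i j; lia. Qed.

Lemma mem_zwin n k : (k \in zwin n) = (`|k| <= n)%N.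
Proof.
apply/mapP/idP => [[i]|kn]; first by rewrite mem_iota => hi ->; lia.
by exists (absz (k + n%:Z)); rewrite ?mem_iota; lia.
Qed.

Lemma big_zwin (V : nmodType) n (F : int -> V) :
  \sum_(k <- zwin n) F k = \sum_(j < n.*2.+1) F (j%:Z - n%:Z).
Proof.
rewrite big_map; have -> : iota 0 n.*2.+1 = index_iota 0 n.*2.+1.
  by rewrite /index_iota subn0.
by rewrite big_mkord.
Qed.

Lemma signr_addn_absz (A : nzRingType) (n j : nat) :
  (-1) ^+ (n + j) = (-1) ^+ `|j%:Z - n%:Z|%N :> A.
Proof. by rewrite -signr_odd -[RHS]signr_odd; congr (_ ^+ _); lia. Qed.

Lemma eq_sum_uniq (T : eqType) (V : nmodType) (s1 s2 : seq T) (F : T -> V) :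
  uniq s1 -> uniq s2 -> (forall x, F x != 0 -> (x \in s1) = (x \in s2)) ->
  \sum_(x <- s1) F x = \sum_(x <- s2) F x.
Proof.
move=> u1 u2 s12.
have nz s : \sum_(x <- s) F x = \sum_(x <- [seq x <- s | F x != 0]) F x.
  rewrite big_filter [LHS](bigID (fun x => F x != 0)) /=.
  by rewrite [X in _ + X]big1 ?addr0 // => x /negPn/eqP.
rewrite nz [RHS]nz; apply/perm_big/uniq_perm; rewrite ?filter_uniq // => x.
by rewrite !mem_filter; case: eqP => //= /eqP /s12.
Qed.

End IntegerIndices.

(** * Truncated series: rings where q^(M+1) = 0 *)

Section Nilpotent.
Variables (R : comNzRingType) (M : nat).
Implicit Types (a b c s q : R).

Lemma expr_nil s i : s ^+ M.+1 = 0 -> (M < i)%N -> s ^+ i = 0.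
Proof. by move=> s0 Mi; rewrite -(subnK Mi) exprD s0 mulr0. Qed.

Lemma expr_nilX s d : s ^+ M.+1 = 0 -> (0 < d)%N -> (s ^+ d) ^+ M.+1 = 0.
Proof. by move=> s0 d0; rewrite -exprM mulnC exprM s0 expr0n; case: d d0. Qed.

Lemma subr1_nil_inv s : s ^+ M.+1 = 0 -> exists h, (1 - s) * h = 1.
Proof.
move=> s0; exists (\sum_(i < M.+1) 1 ^+ (M.+1.-1 - i) * s ^+ i).
by rewrite -subrXX s0 expr1n subr0.
Qed.

Lemma qpoch_inv s n : s ^+ M.+1 = 0 -> exists h, qpoch s n * h = 1.
Proof.
move=> s0; elim: n => [|n [h hE]]; first by exists 1; rewrite qpoch0 mulr1.
have [h' h'E] := subr1_nil_inv (expr_nilX s0 (ltn0Sn n)).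
by exists (h * h'); rewrite qpochS mulrACA hE h'E mulr1.
Qed.

Lemma qpoch_nil s n : s ^+ M.+1 = 0 -> (M <= n)%N -> qpoch s n = qpoch s M.
Proof.
move=> s0; elim: n => [|n IH]; first by rewrite leqn0 => /eqP ->.
rewrite leq_eqVlt => /orP[/eqP<-//|Mn].
by rewrite qpochS IH // (expr_nil s0) ?ltnS // subr0 mulr1.
Qed.

(** A term with |j - n| > M + 1 contains a vanishing power of s. For the others, n >= 2 M + 2 makes
    j and 2 n - j at least M, so every [qpoch] in [qbin_qpoch] is the unit [qpoch s M] and the
    Gaussian binomial is its inverse. *)
Lemma triple_product_nil a b c s n :
  s ^+ M.+1 = 0 -> a * b = s * c -> (M.*2.+2 <= n)%N ->
  qpoch s M * (\prod_(i < n) (1 - a * s ^+ i) * \prod_(i < n) (c - b * s ^+ i))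
  = \sum_(j < n.*2.+1) (-1) ^+ (n + j) * jtp_term a b c s n j.
Proof.
move=> s0 ab Mn; rewrite finite_triple_product // addnn mulr_sumr.
have small r : (M.+1 < r)%N -> s ^+ 'C(r, 2) = 0.
  move=> Mr; apply: (expr_nil s0); case: r Mr => // r Mr.
  by have := mul_bin_diag r.+1 1; rewrite bin1; nia.
apply: eq_bigr => -[j /= jn] _.
have [Mj|jM] := ltnP M.+1 (maxn (j - n) (n - j)).
  suff -> : jtp_term a b c s n j = 0 by rewrite !mulr0.
  rewrite /jtp_term; case: ifP => nj; rewrite small ?mulr0 ?mul0r //; lia.
suff e : qpoch s M * qbin s n.*2 j = 1.
  by rewrite [LHS]mulrA [X in X * _]mulrCA e mulr1.
have [h hE] := qpoch_inv M s0.
have jl : (j <= n.*2)%N by [].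
have := qbin_qpoch s jl; rewrite !(@qpoch_nil s) //; try lia.
move=> /(congr1 ( *%R^~ h)); rewrite -mulrA hE mulr1 => <-.
by rewrite mulrC.
Qed.

End Nilpotent.

(** * Theta series *)

Section ThetaSeries.
Variables (R : comNzRingType) (M : nat).
Implicit Types (q e : R) (n : nat) (k : int).

(** The case a = e q^al, b = e q^be, s = q^(al+be), c = 1, where e^2 = 1 gives a b = s. With be = 0
    the second product starts with the factor 1 - e. *)
Lemma triple_product q e (al be : nat) n :
    q ^+ M.+1 = 0 -> e ^+ 2 = 1 -> (0 < al + be)%N -> (M.*2.+2 <= n)%N ->
  qpoch (q ^+ (al + be)) M *
    (\prod_(i < n) (1 - e * q ^+ al * (q ^+ (al + be)) ^+ i) *
     \prod_(i < n) (1 - e * q ^+ be * (q ^+ (al + be)) ^+ i))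
  = \sum_(k <- zwin n) (- e) ^+ `|k| * q ^+ (al * tri k + be * tri (k - 1)).
Proof.
move=> q0 e2 ab0 Mn; rewrite (triple_product_nil (expr_nilX q0 ab0)) //; last first.
  by rewrite mulr1 mulrACA -expr2 e2 mul1r exprD.
rewrite big_zwin; apply: eq_bigr => -[j /= _] _.
rewrite signr_addn_absz (exprNn e) -mulrA; congr (_ * _).
rewrite /jtp_term !expr1n !mulr1 !exprMn -!exprM.
case: ifP => nj; rewrite -mulrA -exprD.
  have -> : j%:Z - n%:Z = (j - n)%N by lia.
  move: (j - n)%N => r /=; congr (_ * _ ^+ _).
  have -> : tri (r%:Z - 1) = 'C(r, 2).
    by rewrite -tri_inv -tri_opp; congr tri; lia.
  rewrite tri_nat binS bin1; nia.
have -> : j%:Z - n%:Z = - (n - j)%N%:Z by lia.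
move: (n - j)%N => r; rewrite abszN absz_nat; congr (_ * _ ^+ _).
have -> : tri (- r%:Z - 1) = 'C(r.+1, 2).
  by rewrite -tri_inv -tri_nat; congr tri; lia.
rewrite tri_opp binS bin1; nia.
Qed.

Lemma qpoch_tri q n :
  qpoch (q ^+ 3) n * (\prod_(i < n) (1 - q ^+ 2 * (q ^+ 3) ^+ i) *
     \prod_(i < n) (1 - q * (q ^+ 3) ^+ i)) = qpoch q (3 * n).
Proof.
elim: n => [|n IH]; first by rewrite muln0 !qpoch0 !big_ord0 !mulr1.
have -> : (3 * n.+1 = (3 * n).+3)%N by lia.
rewrite !qpochS !big_ord_recr /= -IH -!exprM -!exprS -exprD !add2n mulnS.
by rewrite add3n; ring.
Qed.

Lemma qpoch_double q n :
  qpoch (q ^+ 2) n * \prod_(i < n) (1 - q * (q ^+ 2) ^+ i) = qpoch q (2 * n).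
Proof.
elim: n => [|n IH]; first by rewrite muln0 !qpoch0 !big_ord0 !mulr1.
have -> : (2 * n.+1 = (2 * n).+2)%N by lia.
by rewrite !qpochS !big_ord_recr /= -IH -!exprM -!exprS mulnS add2n; ring.
Qed.

Lemma qpoch_plus q n :
  qpoch q n * \prod_(i < n) (1 + q ^+ i.+1) = qpoch (q ^+ 2) n.
Proof.
rewrite /qpoch -big_split; apply: eq_bigr => i _ /=; rewrite exprAC.
by move: (q ^+ _) => x; ring.
Qed.

(** Euler's pentagonal number theorem: for the exponents 2 and 1 the three products run over the
    residue classes modulo 3 and together give f_1. *)
Lemma pentagonal q n : q ^+ M.+1 = 0 -> (M.*2.+2 <= n)%N ->
  qpoch q M = \sum_(k <- zwin n) (-1) ^+ `|k| * q ^+ (2 * tri k + tri (k - 1)).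
Proof.
move=> q0 Mn; have := triple_product (al := 2) (be := 1) q0 (expr1n _ 2) isT Mn.
rewrite !mul1r expr1 -(@qpoch_nil _ M _ n) ?expr_nilX //; last lia.
rewrite qpoch_tri (@qpoch_nil _ M) //; last lia.
by move=> ->; apply: eq_bigr => k _; rewrite mul1n.
Qed.

(** For the exponents 1 and 1 the series is f_2 P^2, with P the product of 1 - q^i over odd i, and
    f_2 P = f_1. *)
Lemma phi_product q n : q ^+ M.+1 = 0 -> (M.*2.+2 <= n)%N ->
  (\sum_(k <- zwin n) (-1) ^+ `|k| * q ^+ (tri k + tri (k - 1))) * qpoch (q ^+ 2) M
  = qpoch q M ^+ 2.
Proof.
move=> q0 Mn; under eq_bigr do rewrite -[tri _]mul1n -[tri (_ - 1)]mul1n.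
rewrite -(triple_product (al := 1) (be := 1) q0 (expr1n _ 2) isT Mn) !mul1r expr1.
rewrite -(@qpoch_nil _ M _ n) ?expr_nilX //; last lia.
rewrite -(@qpoch_nil _ M q (2 * n)) //; last lia.
by rewrite -qpoch_double; ring.
Qed.

(** Here e = -1 and be = 0: the second product starts with 1 + 1, the source of the 2. On the series
    side, k and -1 - k share an exponent. *)
Lemma psi_product q n : q ^+ M.+1 = 0 -> (M.*2.+2 <= n)%N ->
  (\sum_(k <- zwin n) q ^+ tri k) * qpoch q M = 2 * qpoch (q ^+ 2) M ^+ 2.
Proof.
move=> q0 Mn; have e2 : (-1 : R) ^+ 2 = 1 by rewrite sqrrN expr1n.
have -> : \sum_(k <- zwin n) q ^+ tri k = \sum_(k <- zwin n)
    (- -1) ^+ `|k| * q ^+ (1 * tri k + 0 * tri (k - 1)).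
  by apply: eq_bigr => k _; rewrite mul1n mul0n addn0 opprK expr1n mul1r.
rewrite -(triple_product (al := 1) (be := 0) q0 e2 isT Mn) addn0 expr1 expr0.
have -> : \prod_(i < n) (1 - -1 * q * q ^+ i) = \prod_(i < n) (1 + q ^+ i.+1).
  by apply: eq_bigr => i _; rewrite exprS; ring.
have -> : \prod_(i < n) (1 - -1 * 1 * q ^+ i) = \prod_(i < n) (1 + q ^+ i).
  by apply: eq_bigr => i _; ring.
case: n Mn => // n Mn; rewrite [X in _ * (_ * X)]big_ord_recl expr0.
have h m : (M <= m)%N ->
    qpoch q M * \prod_(i < m) (1 + q ^+ i.+1) = qpoch (q ^+ 2) M.
  move=> Mm; rewrite -(@qpoch_nil _ M q m) // qpoch_plus (@qpoch_nil _ M) //.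
  exact: expr_nilX.
have h1 := h n.+1 ltac:(lia); have h2 := h n ltac:(lia).
rewrite expr2 -{1}h1 -h2; rewrite [2]mulr2n; ring.
Qed.

(** With e = 1 and be = 0 the second product starts with 1 - 1. *)
Lemma theta_vanish q n : q ^+ M.+1 = 0 -> (M.*2.+2 <= n)%N ->
  \sum_(k <- zwin n) (-1) ^+ `|k| * q ^+ tri k = 0.
Proof.
move=> q0 Mn; under eq_bigr => k _.
  rewrite -[tri k]mul1n -[(1 * _)%N]addn0 -[X in (_ + X)%N](mul0n (tri (k - 1))); over.
rewrite -(triple_product (al := 1) (be := 0) q0 (expr1n _ 2) isT Mn).
case: n Mn => // n _.
by rewrite [X in _ * (_ * X)]big_ord_recl !expr0 !mulr1 subrr mul0r !mulr0.
Qed.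

(* Differentiate the triple product at z = 1, where its factor z - 1 vanishes. *)
Lemma jacobi_cube q n : q ^+ M.+1 = 0 -> (M.*2.+2 <= n)%N ->
  \sum_(k <- zwin n) (2 * k + 1)%:~R * (-1) ^+ `|k| * q ^+ tri k = 2 * qpoch q M ^+ 3.
Proof.
move=> q0 Mn.
have q0P : q%:P ^+ M.+1 = 0 by rewrite -rmorphXn /= q0.
(* The variable z is ['X]; clearing its negative powers turns z^k into ['X]^(k+n), so the derivative
   at 1 carries the weight k + n. *)
have := @triple_product_nil _ M (q%:P * 'X) 1 'X q%:P n q0P (mulr1 _) Mn.
have tE j : jtp_term (q%:P * 'X) 1 'X q%:P n j
    = (q ^+ tri (j%:Z - n%:Z))%:P * 'X^j :> {poly R}.
  rewrite /jtp_term expr1n mul1r; case: ifP => nj.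
    have -> : j%:Z - n%:Z = (j - n)%N by lia.
    rewrite tri_nat binS bin1 exprMn rmorphXn /= exprD.
    have -> : 'X^j = 'X^(j - n) * 'X^n :> {poly R} by rewrite -exprD subnK.
    ring.
  have -> : j%:Z - n%:Z = - (n - j)%N%:Z by lia.
  by rewrite tri_opp rmorphXn.
move=> /(congr1 (fun p : {poly R} => p^`().[1])).
case: n Mn tE => // n Mn tE.
have -> : qpoch q%:P M * (\prod_(i < n.+1) (1 - q%:P * 'X * q%:P ^+ i) *
     \prod_(i < n.+1) ('X - 1 * q%:P ^+ i))
  = ('X - 1) * (qpoch q%:P M * \prod_(i < n.+1) (1 - q%:P * 'X * q%:P ^+ i) *
     \prod_(i < n) ('X - 1 * q%:P ^+ i.+1)).
  by rewrite [X in _ * (_ * X)]big_ord_recl expr0 mulr1; ring.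
rewrite derivM derivB derivX derivC subr0 mul1r hornerD !hornerM !hornerE.
rewrite subrr mul0r addr0.
have -> : (qpoch q%:P M).[1] = qpoch q M.
  rewrite horner_prod; apply: eq_bigr => i _.
  by rewrite !hornerE.
have -> : (\prod_(i < n.+1) (1 - q%:P * 'X * q%:P ^+ i)).[1] = qpoch q M.
  rewrite -(@qpoch_nil _ M q n.+1) //; last lia.
  rewrite horner_prod; apply: eq_bigr => i _.
  by rewrite !hornerE exprS.
have -> : (\prod_(i < n) ('X - 1 * q%:P ^+ i.+1)).[1] = qpoch q M.
  rewrite -(@qpoch_nil _ M q n) //; last lia.
  rewrite horner_prod; apply: eq_bigr => i _.
  by rewrite mul1r !hornerE.
have -> : (\sum_(j < n.+1.*2.+1) (-1) ^+ (n.+1 + j) *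
     jtp_term (q%:P * 'X) 1 'X q%:P n.+1 j)^`().[1]
   = \sum_(k <- zwin n.+1) (k + n.+1%:Z)%:~R * ((-1) ^+ `|k| * q ^+ tri k).
  rewrite raddf_sum /= horner_sum big_zwin; apply: eq_bigr => -[j /= _] _.
  rewrite tE signr_addn_absz -[(-1) ^+ _]/((- 1%:P) ^+ _) -polyCN.
  rewrite -rmorphXn /= mulrA -rmorphM /=.
  rewrite mul_polyC derivZ derivXn hornerZ hornerMn hornerXn expr1n subrK.
  by rewrite mulr_natr mulr_natl.
move=> E; have V := theta_vanish q0 Mn.
(* The weight 2 k + 1 is twice the weight obtained plus a constant, and the constant multiplies a
   vanishing series. *)
rewrite (eq_bigr (fun k => 2 * ((k + n.+1%:Z)%:~R * ((-1) ^+ `|k| * q ^+ tri k))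
   + (1 - 2 * n.+1%:R) * ((-1) ^+ `|k| * q ^+ tri k))).
  by rewrite big_split /= -!mulr_sumr V -E mulr0 addr0; ring.
by move=> k _; rewrite !intrD intrM -pmulrn; ring.
Qed.

End ThetaSeries.

(** * Quintuple products *)

Section LatticeSums.

Definition zwin2 n : seq (int * int) := [seq (k, l) | k <- zwin n, l <- zwin n].

Lemma mem_zwin2 n x : (x \in zwin2 n) = (`|x.1| <= n)%N && (`|x.2| <= n)%N.
Proof.
rewrite -!mem_zwin; case: x => k l.
apply/allpairsP/andP => [[[a b] [/= ha hb [-> ->]]]|[ha hb]] //.
by exists (k, l).
Qed.

Lemma zwin2_uniq n : uniq (zwin2 n).
Proof. by apply: allpairs_uniq; rewrite ?zwin_uniq // => -[a b] [c d] _ _ [-> ->]. Qed.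

Lemma big_zwin2 (V : nmodType) n (F : int * int -> V) :
  \sum_(x <- zwin2 n) F x = \sum_(k <- zwin n) \sum_(l <- zwin n) F (k, l).
Proof. exact: big_allpairs. Qed.

(** The three images are disjoint and cover the support of F; where an image leaves s, F
    vanishes. *)
Lemma sum_three_images (T : eqType) (V : nmodType) (s : seq T) (F : T -> V)
    (f0 f1 f2 : T -> T) :
    uniq s -> injective f0 -> injective f1 -> injective f2 ->
    (forall x y, f0 x <> f1 y) -> (forall x y, f0 x <> f2 y) ->
    (forall x y, f1 x <> f2 y) ->
    (forall x, F x != 0 -> x \in s /\
       exists2 y, y \in s & [\/ x = f0 y, x = f1 y | x = f2 y]) ->
  \sum_(x <- s) F x
  = \sum_(x <- s) F (f0 x) + \sum_(x <- s) F (f1 x) + \sum_(x <- s) F (f2 x).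
Proof.
move=> us i0 i1 i2 d01 d02 d12 nz.
have E f : \sum_(x <- s) F (f x) = \sum_(x <- [seq f x | x <- s]) F x.
  by rewrite big_map.
rewrite (E f0) (E f1) (E f2) -!big_cat; apply: eq_sum_uniq => //.
  rewrite !cat_uniq !map_inj_uniq // us /= !andbT.
  apply/andP; split; apply/hasPn => _ /mapP[y _ ->] /=.
    by apply/mapP => -[z _ /esym]; exact: d01.
  by rewrite mem_cat; apply/norP; split; apply/mapP => -[z _ /esym];
    [exact: d02|exact: d12].
move=> x /nz [-> [y ys]]; rewrite !mem_cat.
by case=> ->; rewrite map_f ?orbT.
Qed.

Lemma signr_abszD (A : nzRingType) (k l : int) :
  (-1) ^+ `|k| * (-1) ^+ `|l| = (-1) ^+ `|k + l| :> A.
Proof. by rewrite -exprD -signr_odd -[RHS]signr_odd; congr (_ ^+ _); lia. Qed.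

Lemma signr_absz_opp (A : nzRingType) (k l : int) :
  odd `|k + l| -> (-1) ^+ `|k| = - (-1) ^+ `|l| :> A.
Proof.
move=> kl; rewrite -[LHS]signr_odd -[in RHS]signr_odd -signrN.
by congr (_ ^+ _); lia.
Qed.

Variables (R : comNzRingType) (M : nat).
Implicit Types (q : R).

(** If |k| > M + 1 then [tri k] > M. This bounds the support of the double series. *)
Lemma expr_tri_neq0 q k i :
  q ^+ M.+1 = 0 -> (tri k <= i)%N -> q ^+ i != 0 -> (`|k| <= M.+1)%N.
Proof.
move=> q0 ki; apply: contraNT => kM; rewrite (expr_nil q0) //.
by have := triE k; nia.
Qed.

Lemma sum_prod_zwin2 n (F : int * int -> R) (a b : int -> R) :
  (forall k l, F (k, l) = a k * b l) ->
  \sum_(x <- zwin2 n) F x = (\sum_(k <- zwin n) a k) * \sum_(k <- zwin n) b k.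
Proof.
move=> FE; rewrite big_zwin2 big_distrlr.
by apply: eq_bigr => k _; apply: eq_bigr => l _; exact: FE.
Qed.

(* With u = 2 m + 1 and v = 2 n, the norm identity
   3 (u^2 + 2 v^2) = (u + 2 v)^2 + 2 (u - v)^2 rearranges the double series: its
   index set splits into three cosets of a sublattice of index 3, two of which are
   exchanged by central symmetry, while the contribution of the third vanishes. *)
Lemma cube_phi q n : q ^+ M.+1 = 0 -> (M.*2.+2 <= n)%N ->
  qpoch q M ^+ 3 * 2 *
    (\sum_(k <- zwin n) (-1) ^+ `|k| * q ^+ (tri k + tri (k - 1)))
  = 2 * (\sum_(k <- zwin n) (6 * k + 1)%:~R * q ^+ (2 * tri k + tri (k - 1)))
    * qpoch (q ^+ 2) M.
Proof.
move=> q0 Mn.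
have nil d : (0 < d)%N -> (q ^+ d) ^+ M.+1 = 0 by exact: expr_nilX.
(* The weight is u + 2 v instead of Jacobi's u, so that it depends on one coordinate of the
   sublattice only; the added 2 v comes with a vanishing series in m. *)
pose F (x : int * int) : R := (2 * (x.1 + 2 * x.2) + 1)%:~R *
  ((-1) ^+ `|x.1| * (-1) ^+ `|x.2|) * q ^+ (tri x.1 + (tri x.2 + tri (x.2 - 1))).
have -> : qpoch q M ^+ 3 * 2 *
    (\sum_(k <- zwin n) (-1) ^+ `|k| * q ^+ (tri k + tri (k - 1)))
    = \sum_(x <- zwin2 n) F x.
  rewrite (mulrC _ 2) -(jacobi_cube q0 Mn).
  pose a k : R := (2 * k + 1)%:~R * (-1) ^+ `|k| * q ^+ tri k.
  pose b k : R := (-1) ^+ `|k| * q ^+ (tri k + tri (k - 1)).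
  pose c k : R := (-1) ^+ `|k| * q ^+ tri k.
  pose d k : R := (4 * k)%:~R * b k.
  rewrite (eq_bigr (fun x => a x.1 * b x.2 + c x.1 * d x.2)) => [|x _]; last first.
    by rewrite /F /a /d /c /b exprD !(intrD, intrM); ring.
  rewrite big_split /= (@sum_prod_zwin2 _ (fun x => a x.1 * b x.2) a b) //.
  rewrite (@sum_prod_zwin2 _ (fun x => c x.1 * d x.2) c d) //.
  by rewrite [\sum_(k <- _) c k](theta_vanish q0 Mn) mul0r addr0.
(* The maps parametrize the classes 0, -1 and 1 of k + 2 l modulo 3; the second is the first
   followed by (k, l) -> (-1 - k, -l). *)
rewrite (@sum_three_images _ _ _ _ (fun x => (x.1 + 2 * x.2, x.1 - x.2))
  (fun x => (- 1 - (x.1 + 2 * x.2), - (x.1 - x.2)))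
  (fun x => (x.1 + 1 + 2 * x.2, x.1 - x.2)) (zwin2_uniq n)); first last.
- move=> [k l] Fn0; have q1 : q ^+ (tri k + (tri l + tri (l - 1))) != 0.
    by apply: contraNneq Fn0 => e; rewrite /F /= e mulr0.
  have kM : (`|k| <= M.+1)%N by apply: (expr_tri_neq0 q0 _ q1); lia.
  have lM : (`|l| <= M.+1)%N by apply: (expr_tri_neq0 q0 _ q1); lia.
  split; first by rewrite mem_zwin2 /=; lia.
  (* Since k and l are at most M + 1 in absolute value, the preimage found below stays within 2 M +
     2 <= n. *)
  pose r := ((k + 2 * l + 1) %/ 3)%Z.
  have : k + 2 * l = 3 * r \/ k + 2 * l = 3 * r - 1 \/ k + 2 * l = 3 * r + 1.
    by rewrite /r; lia.
  case=> [e|[e|e]].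
  + exists (r, r - l); first by rewrite mem_zwin2 /=; lia.
    by constructor 1; congr pair; rewrite /=; lia.
  + exists (- r, - r + l); first by rewrite mem_zwin2 /=; lia.
    by constructor 2; congr pair; rewrite /=; lia.
  + exists (r, r - l); first by rewrite mem_zwin2 /=; lia.
    by constructor 3; congr pair; rewrite /=; lia.
- by move=> [a b] [c d] /= [] *; lia.
- by move=> [a b] [c d] /= [] *; lia.
- by move=> [a b] [c d] /= [] *; lia.
- by move=> [a b] [c d] /= [] *; congr pair; lia.
- by move=> [a b] [c d] /= [] *; congr pair; lia.
- by move=> [a b] [c d] /= [] *; congr pair; lia.
(* Central symmetry negates both the weight and the sign, so it preserves F. *)
rewrite [X in _ + X + _](eq_bigr (fun x => F (x.1 + 2 * x.2, x.1 - x.2))); last first.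
  move=> [r t] _; rewrite /F /= tri_inv !signr_abszD.
  have -> : 2 * (-1 - (r + 2 * t) + 2 * - (r - t)) + 1
    = - (2 * (r + 2 * t + 2 * (r - t)) + 1) by lia.
  have -> : tri (- (r - t)) = tri (r - t - 1) by rewrite -tri_inv; congr tri; lia.
  have -> : tri (- (r - t) - 1) = tri (r - t) by rewrite -tri_inv; congr tri; lia.
  rewrite [X in (_ + X)%N]addnC rmorphN /= mulNr -mulrN; congr (_ * _ * _).
  by rewrite -signr_odd -signrN -[RHS]signr_odd; congr (_ ^+ _); lia.
rewrite (@sum_prod_zwin2 n (fun x => F (x.1 + 2 * x.2, x.1 - x.2))
  (fun k => (6 * k + 1)%:~R * q ^+ (2 * tri k + tri (k - 1)))
  (fun k => (-1) ^+ `|k| * (q ^+ 2) ^+ (2 * tri k + tri (k - 1)))); last first.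
  move=> r t; rewrite /F /= signr_abszD -exprM mulrACA -exprD.
  congr (_%:~R * _ * _ ^+ _); first lia.
    by rewrite -signr_odd -[RHS]signr_odd; congr (_ ^+ _); lia.
  have := triE (r + 2 * t); have := triE (r - t); have := triE (r - t - 1);
  have := triE r; have := triE (r - 1); have := triE t; have := triE (t - 1); lia.
rewrite (@sum_prod_zwin2 n (fun x => F (x.1 + 1 + 2 * x.2, x.1 - x.2))
  (fun k => - (6 * k + 3)%:~R * q ^+ (3 * tri k + 1))
  (fun k => (-1) ^+ `|k| * (q ^+ 6) ^+ tri k)); last first.
  move=> r t; rewrite /F /= signr_abszD -exprM mulrACA -exprD.
  rewrite mulNr -mulrN.
  congr (_%:~R * _ * _ ^+ _); first lia.
    by apply: signr_absz_opp; lia.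
  have := triE (r + 1 + 2 * t); have := triE (r - t); have := triE (r - t - 1);
  have := triE r; have := triE t; lia.
rewrite (theta_vanish (nil 6 isT) Mn) mulr0 addr0 (@pentagonal _ M (q ^+ 2) n) ?nil //.
by rewrite -mulr2n -[in RHS]mulrA mulr_natl.
Qed.

(* The rearrangement of [cube_phi], now with u = 2 n + 1 and v = 2 m + 1. *)
Lemma cube_psi q n : q ^+ M.+1 = 0 -> (M.*2.+2 <= n)%N ->
  2 * qpoch (q ^+ 2) M ^+ 3 * (\sum_(k <- zwin n) q ^+ tri k)
  = 4 * (\sum_(k <- zwin n) (3 * k + 1)%:~R *
           ((-1) ^+ `|k| * q ^+ (5 * tri k + tri (k - 1)))) * qpoch q M.
Proof.
move=> q0 Mn.
have nil d : (0 < d)%N -> (q ^+ d) ^+ M.+1 = 0 by exact: expr_nilX.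
(* The weight is u + v: Jacobi's weight v for [q ^+ 2], plus u, which comes with a vanishing series
   in m. *)
pose F (x : int * int) : R := (2 * (x.1 + x.2 + 1))%:~R *
  (-1) ^+ `|x.1| * q ^+ (2 * tri x.1 + tri x.2).
have -> : 2 * qpoch (q ^+ 2) M ^+ 3 * (\sum_(k <- zwin n) q ^+ tri k)
    = \sum_(x <- zwin2 n) F x.
  rewrite -(jacobi_cube (nil 2 isT) Mn).
  pose a k : R := (2 * k + 1)%:~R * (-1) ^+ `|k| * (q ^+ 2) ^+ tri k.
  pose b k : R := q ^+ tri k.
  pose c k : R := (-1) ^+ `|k| * (q ^+ 2) ^+ tri k.
  pose d k : R := (2 * k + 1)%:~R * b k.
  rewrite (eq_bigr (fun x => a x.1 * b x.2 + c x.1 * d x.2)) => [|x _]; last first.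
    by rewrite /F /a /d /c /b exprD exprM !(intrD, intrM); ring.
  rewrite big_split /= (@sum_prod_zwin2 _ (fun x => a x.1 * b x.2) a b) //.
  rewrite (@sum_prod_zwin2 _ (fun x => c x.1 * d x.2) c d) //.
  by rewrite [\sum_(k <- _) c k](theta_vanish (nil 2 isT) Mn) mul0r addr0.
(* The maps parametrize the classes 0, 1 and -1 of k + l modulo 3; the symmetry is now (k, l) -> (-1
   - k, -1 - l). *)
rewrite (@sum_three_images _ _ _ _ (fun x => (x.1 + x.2, 2 * x.1 - x.2))
  (fun x => (- 1 - (x.1 + x.2), - 1 - (2 * x.1 - x.2)))
  (fun x => (x.1 + x.2, 2 * x.1 - 1 - x.2)) (zwin2_uniq n)); first last.
- move=> [k l] Fn0; have q1 : q ^+ (2 * tri k + tri l) != 0.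
    by apply: contraNneq Fn0 => e; rewrite /F /= e mulr0.
  have kM : (`|k| <= M.+1)%N by apply: (expr_tri_neq0 q0 _ q1); lia.
  have lM : (`|l| <= M.+1)%N by apply: (expr_tri_neq0 q0 _ q1); lia.
  split; first by rewrite mem_zwin2 /=; lia.
  pose r := ((k + l + 1) %/ 3)%Z.
  have : k + l = 3 * r \/ k + l = 3 * r - 1 \/ k + l = 3 * r + 1 by rewrite /r; lia.
  case=> [e|[e|e]].
  + exists (r, k - r); first by rewrite mem_zwin2 /=; lia.
    by constructor 1; congr pair; rewrite /=; lia.
  + exists (r, k - r); first by rewrite mem_zwin2 /=; lia.
    by constructor 3; congr pair; rewrite /=; lia.
  + exists (- r - 1, r - k); first by rewrite mem_zwin2 /=; lia.
    by constructor 2; congr pair; rewrite /=; lia.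
- by move=> [a b] [c d] /= [] *; lia.
- by move=> [a b] [c d] /= [] *; lia.
- by move=> [a b] [c d] /= [] *; lia.
- by move=> [a b] [c d] /= [] *; congr pair; lia.
- by move=> [a b] [c d] /= [] *; congr pair; lia.
- by move=> [a b] [c d] /= [] *; congr pair; lia.
rewrite [X in _ + X + _](eq_bigr (fun x => F (x.1 + x.2, 2 * x.1 - x.2))); last first.
  move=> [r t] _; rewrite /F /= !tri_inv.
  have -> : 2 * (-1 - (r + t) + (-1 - (2 * r - t)) + 1)
    = - (2 * (r + t + (2 * r - t) + 1)) by lia.
  rewrite rmorphN /= mulNr -mulrN; congr (_ * _ * _).
  by rewrite -signr_odd -signrN -[RHS]signr_odd; congr (_ ^+ _); lia.
rewrite (@sum_prod_zwin2 n (fun x => F (x.1 + x.2, 2 * x.1 - x.2))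
  (fun k => 2 * ((3 * k + 1)%:~R * ((-1) ^+ `|k| * q ^+ (5 * tri k + tri (k - 1)))))
  (fun k => (-1) ^+ `|k| * q ^+ (2 * tri k + tri (k - 1)))); last first.
  move=> r t; rewrite /F /= -signr_abszD.
  have -> : (2 * tri (r + t) + tri (2 * r - t)
      = (5 * tri r + tri (r - 1)) + (2 * tri t + tri (t - 1)))%N.
    have := triE (r + t); have := triE (2 * r - t).
    have := triE r; have := triE (r - 1); have := triE t; have := triE (t - 1); lia.
  rewrite exprD; have -> : 2 * (r + t + (2 * r - t) + 1) = 2 * (3 * r + 1) by lia.
  by rewrite intrM; ring.
rewrite (@sum_prod_zwin2 n (fun x => F (x.1 + x.2, 2 * x.1 - 1 - x.2))
  (fun k => (6 * k)%:~R * (-1) ^+ `|k| * q ^+ (3 * (tri k + tri (k - 1))))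
  (fun k => (-1) ^+ `|k| * (q ^+ 3) ^+ tri k)); last first.
  move=> r t; rewrite /F /= -signr_abszD -exprM.
  have -> : (2 * tri (r + t) + tri (2 * r - 1 - t)
      = 3 * (tri r + tri (r - 1)) + 3 * tri t)%N.
    have := triE (r + t); have := triE (2 * r - 1 - t).
    have := triE r; have := triE (r - 1); have := triE t; lia.
  rewrite exprD; have -> : 2 * (r + t + (2 * r - 1 - t) + 1) = 6 * r by lia.
  by ring.
rewrite (theta_vanish (nil 3 isT) Mn) mulr0 addr0 -(pentagonal q0 Mn) -mulr_sumr.
by ring.
Qed.

End LatticeSums.

(** * Coefficients of the generating function *)

Lemma legendre_nonresidue (a x : int) (l : nat) :
  (0 < l)%N -> legendre a l = -1 -> (x ^+ 2 <> a %[mod l])%Z.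
Proof.
move=> l0; rewrite /legendre; case: ifP => // _; case: ifPn => // /existsPn no _ xa.
have xl : (absz (x %% l)%Z < l)%N by lia.
have /eqP := no (Ordinal xl); apply => /=.
have -> : (absz (x %% l)%Z)%:Z = (x %% l)%Z by lia.
by rewrite modzXm.
Qed.

(** The Frobenius map is additive, so p^l is a polynomial in X^l. *)
Lemma coef_pFrobenius (R : comNzRingType) (l : nat) (p : {poly R}) i :
  l \in [pchar R] -> ~~ (l %| i)%N -> (p ^+ l)`_i = 0.
Proof.
move=> chR; have chP : l \in [pchar {poly R}] by rewrite pchar_poly.
have l0 : (0 < l)%N by apply: prime_gt0; case/andP: chR.
elim/poly_ind: p i => [|p c IH] i li; first by rewrite expr0n -[l]prednK //= coef0.
rewrite -(pFrobenius_autE chP) rmorphD /= !pFrobenius_autE exprMn coefD coefMXn.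
rewrite -polyC_exp coefC; case: eqP li => [->|_ li]; first by rewrite dvdn0.
rewrite addr0; case: ltnP => // le_li; apply: IH.
by rewrite -{1}(subnK le_li) dvdn_addl // in li.
Qed.

(** The exponents differ by a multiple of l of either sign; the inverse x of h handles m < n. *)
Lemma expr_congr (R : comNzRingType) (x h : R) (l m n : nat) :
  x * h = 1 -> m = n %[mod l] -> exists y, h ^+ m = h ^+ n * y ^+ l.
Proof.
move=> xh mn; have [le_nm|/ltnW le_mn] := leqP n m.
  have /dvdnP[c ec] : (l %| m - n)%N by rewrite -eqn_mod_dvd // mn.
  by exists (h ^+ c); rewrite -exprM -ec -exprD subnKC.
have /dvdnP[c ec] : (l %| n - m)%N by rewrite -eqn_mod_dvd // mn.
exists (x ^+ c); rewrite -exprM -ec -{1}(subnKC le_mn) exprD -mulrA -exprMn.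
by rewrite [h * x]mulrC xh expr1n mulr1.
Qed.

(** * The generating function modulo l-th powers *)

Section GeneratingFunction.
Variables (R : comNzRingType) (f : {rmorphism {poly int} -> R}) (N : nat).
Hypothesis fX0 : f 'X ^+ N.+1 = 0.
Local Notation q := (f 'X).

Lemma geom_truncV n : (0 < n)%N -> f (geom_trunc N n) * (1 - q ^+ n) = 1.
Proof.
move=> n0; rewrite /geom_trunc rmorph_sum /= mulrC.
transitivity (1 ^+ N.+1 - (q ^+ n) ^+ N.+1).
  rewrite subrXX; congr (_ * _); apply: eq_bigr => m _.
  by rewrite !rmorphXn expr1n mul1r exprM.
by rewrite expr1n (expr_nilX fX0) // subr0.
Qed.

Lemma overpart_qpoch (k j : nat) :
  f (overpart_trunc k j N) * qpoch q N ^+ (k + j) = qpoch (q ^+ 2) N ^+ j.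
Proof.
rewrite -(qpoch_plus q N) exprMn [RHS]mulrC exprD mulrA; congr (_ * _).
rewrite /overpart_trunc big_add1 big_mkord rmorph_prod /= -!prodrXl -big_split /=.
apply: eq_bigr => i _.
rewrite !(rmorphM, rmorphXn, rmorphD, rmorph1) /= -mulrA -exprMn geom_truncV //.
by rewrite expr1n mulr1.
Qed.

(** The integer exponents of f_1 and f_2 are represented as differences a1 - b1 and a2 - b2 of
    natural numbers; the hypotheses read k + j = b1 - a1 and -j = b2 - a2 modulo l. *)
Lemma overpart_theta (l k j a1 b1 a2 b2 : nat) :
    k + j + a1 = b1 %[mod l] -> j + b2 = a2 %[mod l] ->
  exists y, f (overpart_trunc k j N) * (qpoch q N ^+ b1 * qpoch (q ^+ 2) N ^+ b2)
    = qpoch q N ^+ a1 * qpoch (q ^+ 2) N ^+ a2 * y ^+ l.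
Proof.
move=> h1 h2; have pE := overpart_qpoch k j.
have [g1 e1] := qpoch_inv N fX0.
have [g2 e2] := qpoch_inv N (expr_nilX fX0 (ltn0Sn 1)).
have [y1 y1E] := expr_congr e1 h1.
have [y2 y2E] : exists y,
    qpoch (q ^+ 2) N ^+ (j + b2) = qpoch (q ^+ 2) N ^+ a2 * y ^+ l.
  by apply: expr_congr h2; rewrite mulrC; exact: e2.
exists (y1 * y2).
have eX n : qpoch q N ^+ n * g1 ^+ n = 1 by rewrite -exprMn e1 expr1n.
have pE' : f (overpart_trunc k j N) = qpoch (q ^+ 2) N ^+ j * g1 ^+ (k + j).
  by rewrite -pE -mulrA eX mulr1.
transitivity (qpoch q N ^+ a1 * g1 ^+ a1 * f (overpart_trunc k j N) *
    (qpoch q N ^+ b1 * qpoch (q ^+ 2) N ^+ b2)); first by rewrite eX mul1r.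
transitivity (qpoch q N ^+ a1 * qpoch q N ^+ b1 * (g1 ^+ (k + j + a1)) *
    qpoch (q ^+ 2) N ^+ (j + b2)).
  by rewrite pE' (exprD g1 (k + j)) (exprD _ j); ring.
by rewrite y1E y2E exprMn -[RHS]mul1r -(eX b1); ring.
Qed.

End GeneratingFunction.

(* u f_1^a1 f_2^a2 / (f_1^b1 f_2^b2) = sum_k w_k q^(e_k), modulo q^(M+1), where
   f_d is the product of the 1 - q^(d i). *)
Definition theta_identity (u a1 b1 a2 b2 : nat) (w : int -> int) (e : int -> nat) :=
  forall (R : comNzRingType) (M : nat) (q : R) (n : nat),
    q ^+ M.+1 = 0 -> (M.*2.+2 <= n)%N ->
    u%:R * (qpoch q M ^+ a1 * qpoch (q ^+ 2) M ^+ a2)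
    = (\sum_(k <- zwin n) (w k)%:~R * q ^+ e k)
      * (qpoch q M ^+ b1 * qpoch (q ^+ 2) M ^+ b2).

Lemma overpart_series (R : comNzRingType) (f : {rmorphism {poly int} -> R})
    (N l k j u a1 b1 a2 b2 : nat) (w : int -> int) (e : int -> nat) :
    f 'X ^+ N.+1 = 0 -> theta_identity u a1 b1 a2 b2 w e ->
    k + j + a1 = b1 %[mod l] -> j + b2 = a2 %[mod l] ->
  exists y, u%:R * f (overpart_trunc k j N)
    = (\sum_(i <- zwin N.*2.+2) (w i)%:~R * f 'X ^+ e i) * y ^+ l.
Proof.
move=> fX0 /(_ R N (f 'X) _ fX0 (leqnn _)) tE h1 h2.
have [y yE] := overpart_theta fX0 h1 h2; exists y.
have [g1 e1] := qpoch_inv N fX0.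
have [g2 e2] := qpoch_inv N (expr_nilX fX0 (ltn0Sn 1)).
move: tE yE; set P := f (overpart_trunc _ _ _); set S := \sum_(i <- _) _.
set D := qpoch _ N ^+ b1 * _; set T := qpoch _ N ^+ a1 * _ => tE yE.
have D1 : D * (g1 ^+ b1 * g2 ^+ b2) = 1.
  by rewrite mulrACA -!exprMn e1 e2 !expr1n mulr1.
have PS : u%:R * P * D = S * y ^+ l * D by rewrite -mulrA yE mulrA tE mulrAC.
by rewrite -[LHS]mulr1 -[X in _ * X]D1 mulrA PS -(mulrA (S * _)) D1 mulr1.
Qed.

(** * Extracting coefficients in F_l[X] / (X^(N+1)) *)

Section Coefficients.
Variables (l N : nat).
Hypothesis pl : prime l.

Local Notation F := 'F_l.
Local Notation A := (qpoly ('X^(N.+1) : {poly F})).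
Local Notation proj := (in_qpoly ('X^(N.+1) : {poly F})).
Local Notation q := (proj 'X).

Lemma qX_nil : q ^+ N.+1 = 0.
Proof.
rewrite -rmorphXn; apply/val_inj => /=; rewrite mk_monic_Xn.
exact: Pdiv.RingMonic.rmodpp (monicXn _ _).
Qed.

Lemma coef_in_qpolyXn (p : {poly F}) i : (i <= N)%N -> (polyn (proj p))`_i = p`_i.
Proof.
move=> iN; have -> : proj p = proj (take_poly N.+1 p).
  rewrite -{1}(poly_take_drop N.+1 p) rmorphD rmorphM rmorphXn /=.
  by rewrite qX_nil mulr0 addr0.
rewrite in_qpoly_small ?coef_take_poly ?ltnS ?iN //.
by rewrite mk_monic_Xn size_polyXn ltnS size_take_poly.
Qed.

Lemma coef_theta_eq0 (p : {poly F}) (y : A) (u : nat) (s : seq int)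
    (w x : int -> int) (e : int -> nat) (a b d : int) :
    ~~ (l %| u)%N -> u%:R * proj p = (\sum_(k <- s) (w k)%:~R * q ^+ e k) * y ^+ l ->
    (forall k, a * (e k)%:Z + b = x k ^+ 2) -> (N%:Z = d %[mod l])%Z ->
    legendre (a * d + b) l = -1 \/
      (a * d + b = 0 %[mod l])%Z /\ (forall k, (l %| x k)%Z -> (l %| w k)%Z) ->
  p`_N = 0.
Proof.
move=> lu pE xE Nd cond; have chF : l \in [pchar F] by exact: pchar_Fp.
(* Lifting y to a polynomial lets the Frobenius argument apply to Y^l; coefficients up to N survive
   the projection. *)
pose Y : {poly F} := val y.
have yE : y = proj Y by apply/val_inj/esym/in_qpoly_small; exact: size_mk_monic.
have qE i : q ^+ i = proj 'X^i by rewrite -rmorphXn.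
have {}pE : proj (u%:R * p) = proj ((\sum_(k <- s) (w k)%:~R * 'X^(e k)) * Y ^+ l).
  rewrite !(rmorphM, rmorph_nat, rmorph_sum) /= rmorphXn /= -yE pE.
  by congr (_ * _); apply: eq_bigr => k _; rewrite rmorphM rmorph_int /= -qE.
have /eqP : (u%:R * p)`_N = 0.
  rewrite -coef_in_qpolyXn // pE coef_in_qpolyXn // mulr_suml coef_sum.
  apply: big1 => k _; rewrite -mulrA.
  rewrite -[(w k)%:~R](rmorph_int (polyC : F -> {poly F})) coefCM coefXnM.
  case: ltnP => [|eN]; rewrite ?mulr0 //.
  (* Y^l has nonzero coefficients only at multiples of l, which forces e_k = N modulo l. *)
  have [lN|] := boolP (l %| N - e k)%N; last first.
    by move/(coef_pFrobenius _ chF) ->; rewrite mulr0.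
  have xa : (x k ^+ 2 = a * d + b %[mod l])%Z.
    rewrite -xE; apply/eqP; rewrite eqz_mod_dvd.
    have -> : a * e k + b - (a * d + b) = a * ((N%:Z - d) - (N - e k)%N%:Z).
      by rewrite -subzn //; ring.
    by apply/dvdz_mull/rpredB => //; rewrite -eqz_mod_dvd; apply/eqP.
  case: cond => [/(legendre_nonresidue (prime_gt0 pl)) /(_ xa) //|[ab0 xw]].
  suff /xw : (l %| x k)%Z by rewrite (dvdz_pcharf chF) => /eqP ->; rewrite mul0r.
  have /dvdz_mod0P : (x k ^+ 2 %% l)%Z = 0 by rewrite xa ab0 mod0z.
  by rewrite !dvdzE abszX /= Euclid_dvdX // andbT.
rewrite -[u%:R](rmorph_nat (polyC : F -> {poly F})) coefCM mulf_eq0 -(dvdn_pcharf chF).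
by rewrite (negPf lu) => /eqP.
Qed.

Lemma overpart_mod_eq0 (k j u a1 b1 a2 b2 : nat) (w x : int -> int)
    (e : int -> nat) (a b d : int) :
    ~~ (l %| u)%N -> theta_identity u a1 b1 a2 b2 w e ->
    k + j + a1 = b1 %[mod l] -> j + b2 = a2 %[mod l] ->
    (forall i, a * (e i)%:Z + b = x i ^+ 2) -> (N%:Z = d %[mod l])%Z ->
    legendre (a * d + b) l = -1 \/
      (a * d + b = 0 %[mod l])%Z /\ (forall i, (l %| x i)%Z -> (l %| w i)%Z) ->
  (overpart_nat k j N = 0 %[mod l])%Z.
Proof.
move=> lu tE h1 h2 xE Nd cond.
(* Coefficients are reduced modulo l and powers beyond X^N are discarded. *)
pose f : {rmorphism {poly int} -> A} :=
  GRing.RMorphism.clone _ _ (in_qpoly _ \o map_poly (intr : int -> F)) _.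
have fX : f 'X = q by rewrite /= map_polyX.
have fX0 : f 'X ^+ N.+1 = 0 by rewrite fX qX_nil.
have [y] := overpart_series fX0 tE h1 h2; rewrite fX => yE.
have := coef_theta_eq0 lu yE xE Nd cond.
rewrite coef_map /= => /eqP.
by rewrite -(dvdz_pcharf (pchar_Fp pl)) => /dvdz_mod0P; rewrite mod0z.
Qed.

End Coefficients.

(** * The eight theta series, in the order of the cases *)

Section Identities.
Local Notation sg k := ((-1) ^+ `|k| : int).

Lemma theta_f1 : theta_identity 1 1 0 0 0
  (fun k => sg k) (fun k => 2 * tri k + tri (k - 1))%N.
Proof.
move=> R M q n q0 Mn; rewrite !expr0 expr1 !mulr1 mul1r (pentagonal q0 Mn).
by apply: eq_bigr => k _; rewrite rmorph_sign.
Qed.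

Lemma theta_f2 : theta_identity 1 0 0 1 0
  (fun k => sg k) (fun k => 2 * (2 * tri k + tri (k - 1)))%N.
Proof.
move=> R M q n q0 Mn; rewrite !expr0 expr1 !mulr1 !mul1r.
rewrite (pentagonal (expr_nilX q0 (ltn0Sn 1)) Mn).
by apply: eq_bigr => k _; rewrite rmorph_sign exprM.
Qed.

Lemma theta_f1_cube : theta_identity 2 3 0 0 0
  (fun k => (2 * k + 1) * sg k) (fun k => tri k).
Proof.
move=> R M q n q0 Mn; rewrite !expr0 !mulr1 -(jacobi_cube q0 Mn).
by apply: eq_bigr => k _; rewrite intrM rmorph_sign.
Qed.

Lemma theta_f2_cube : theta_identity 2 0 0 3 0
  (fun k => (2 * k + 1) * sg k) (fun k => 2 * tri k)%N.
Proof.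
move=> R M q n q0 Mn; rewrite !expr0 !mulr1 mul1r.
rewrite -(jacobi_cube (expr_nilX q0 (ltn0Sn 1)) Mn).
by apply: eq_bigr => k _; rewrite intrM rmorph_sign exprM.
Qed.

Lemma theta_phi : theta_identity 1 2 0 0 1
  (fun k => sg k) (fun k => tri k + tri (k - 1))%N.
Proof.
move=> R M q n q0 Mn; rewrite !expr0 expr1 mulr1 !mul1r -(phi_product q0 Mn).
by congr (_ * _); apply: eq_bigr => k _; rewrite rmorph_sign.
Qed.

Lemma theta_psi : theta_identity 2 0 1 2 0 (fun=> 1) (fun k => tri k).
Proof.
move=> R M q n q0 Mn; rewrite !expr0 expr1 mulr1 mul1r -(psi_product q0 Mn).
by congr (_ * _); apply: eq_bigr => k _; rewrite mul1r.
Qed.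

(** [cube_phi] times f_2, since f_2 times the phi series is f_1^2; the 2 stays, as it may not be
    cancellable. *)
Lemma theta_quintuple1 : theta_identity 2 5 0 0 2
  (fun k => 2 * (6 * k + 1)) (fun k => 2 * tri k + tri (k - 1))%N.
Proof.
move=> R M q n q0 Mn; rewrite !expr0 mulr1 mul1r.
under eq_bigr do rewrite intrM -mulrA.
rewrite -mulr_sumr (_ : 2%:~R = 2) // [qpoch _ M ^+ 2]expr2.
rewrite [RHS]mulrA -(cube_phi q0 Mn) -[RHS]mulrA (phi_product q0 Mn); ring.
Qed.

(** [cube_psi] times f_1, since f_1 times the psi series is 2 f_2^2. *)
Lemma theta_quintuple2 : theta_identity 4 0 2 5 0
  (fun k => 4 * ((3 * k + 1) * sg k)) (fun k => 5 * tri k + tri (k - 1))%N.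
Proof.
move=> R M q n q0 Mn; rewrite !expr0 mulr1 mul1r.
under eq_bigr do rewrite intrM intrM rmorph_sign -!mulrA.
rewrite -mulr_sumr (_ : 4%:~R = 4) // [qpoch q M ^+ 2]expr2.
rewrite [RHS]mulrA -(cube_psi q0 Mn) -[RHS]mulrA (psi_product q0 Mn); ring.
Qed.

End Identities.

(** * Completing the square in the exponents *)

Lemma sq_tri k : 8 * (tri k)%:Z + 1 = (2 * k + 1) ^+ 2.
Proof. by rewrite expr2; have := triE k; lia. Qed.

Lemma sq_2tri k : 4 * (2 * tri k)%:Z + 1 = (2 * k + 1) ^+ 2.
Proof. by rewrite expr2; have := triE k; lia. Qed.

Lemma sq_f1 k : 24 * (2 * tri k + tri (k - 1))%:Z + 1 = (6 * k + 1) ^+ 2.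
Proof. by rewrite expr2; have := triE k; have := triE (k - 1); lia. Qed.

Lemma sq_f2 k : 12 * (2 * (2 * tri k + tri (k - 1)))%:Z + 1 = (6 * k + 1) ^+ 2.
Proof. by rewrite expr2; have := triE k; have := triE (k - 1); lia. Qed.

Lemma sq_phi k : 1 * (tri k + tri (k - 1))%:Z + 0 = k ^+ 2.
Proof. by rewrite expr2; have := triE k; have := triE (k - 1); lia. Qed.

Lemma sq_quintuple2 k : 3 * (5 * tri k + tri (k - 1))%:Z + 1 = (3 * k + 1) ^+ 2.
Proof. by rewrite expr2; have := triE k; have := triE (k - 1); lia. Qed.

(** Turns a congruence with a possibly negative residue into one between natural numbers. *)
Lemma modz_addn (l m a b : nat) (c : int) :
  (m%:Z = c %[mod l])%Z -> c + a%:Z = b -> m + a = b %[mod l].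
Proof.
move=> mc cb; have : ((m + a)%:Z = b %[mod l])%Z.
  by rewrite PoszD -modzDml mc modzDml cb.
by rewrite !modz_nat => -[].
Qed.

Lemma modz_subn (l m a b : nat) (c : int) :
  (- m%:Z = c %[mod l])%Z -> a%:Z - c = b -> m + a = b %[mod l].
Proof.
move=> mc cb; apply: (@modz_addn _ _ _ _ (- c)); last by rewrite addrC.
move/eqP: mc; rewrite eqz_mod_dvd => mc; apply/eqP; rewrite eqz_mod_dvd.
by rewrite (_ : m%:Z - - c = - (- m%:Z - c)) ?rpredN //; ring.
Qed.

(** The multipliers u = 1, 2, 4 of the theta identities are thus invertible modulo l. *)
Lemma prime_ndvd_pow2 (l e : nat) : (3 <= l)%N -> prime l -> ~~ (l %| 2 ^ e)%N.
Proof.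
move=> l3 pl; by rewrite Euclid_dvdX //; apply/negP => /andP[/dvdn_leq]; lia.
Qed.

Theorem theorem4p17 (k j l : nat) (delta : int)
    (hj : (0 < j)%N) (hjk : (j <= k)%N) :
  (   [/\ (5 <= l)%N, prime l,
          ((k + j)%:Z = -1 %[mod l])%Z /\ (- j%:Z = 0 %[mod l])%Z &
          legendre (24 * delta + 1) l = -1]
   \/ [/\ (5 <= l)%N, prime l,
          ((k + j)%:Z = 0 %[mod l])%Z /\ (- j%:Z = -1 %[mod l])%Z &
          legendre (12 * delta + 1) l = -1]
   \/ [/\ (5 <= l)%N, prime l,
          ((k + j)%:Z = -3 %[mod l])%Z /\ (- j%:Z = 0 %[mod l])%Z &
          legendre (8 * delta + 1) l = -1 \/ (8 * delta + 1 = 0 %[mod l])%Z]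
   \/ [/\ (5 <= l)%N, prime l,
          ((k + j)%:Z = 0 %[mod l])%Z /\ (- j%:Z = -3 %[mod l])%Z &
          legendre (4 * delta + 1) l = -1 \/ (4 * delta + 1 = 0 %[mod l])%Z]
   \/ [/\ (3 <= l)%N, prime l,
          ((k + j)%:Z = -2 %[mod l])%Z /\ (- j%:Z = 1 %[mod l])%Z &
          legendre delta l = -1]
   \/ [/\ (3 <= l)%N, prime l,
          ((k + j)%:Z = 1 %[mod l])%Z /\ (- j%:Z = -2 %[mod l])%Z &
          legendre (8 * delta + 1) l = -1]
   \/ [/\ (5 <= l)%N, prime l,
          ((k + j)%:Z = -5 %[mod l])%Z /\ (- j%:Z = 2 %[mod l])%Z &
          legendre (24 * delta + 1) l = -1 \/ (24 * delta + 1 = 0 %[mod l])%Z]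
   \/ [/\ (5 <= l)%N, prime l,
          ((k + j)%:Z = 2 %[mod l])%Z /\ (- j%:Z = -5 %[mod l])%Z &
          legendre (3 * delta + 1) l = -1 \/ (3 * delta + 1 = 0 %[mod l])%Z]) ->
  forall n : nat, (overpart k j (l%:Z * n%:Z + delta) = 0 %[mod l])%Z.

Proof.
(* At a negative argument [overpart] is 0 by definition. *)
move=> cases n; case Nd: (_ + _) => [N|m] //=.
have {n} Nd : (N%:Z = delta %[mod l])%Z by rewrite -Nd mulrC modzMDl.
case: cases => [|[|[|[|[|[|[|]]]]]]] [l_ge pl [hkj hj'] leg].
- apply: (overpart_mod_eq0 pl (prime_ndvd_pow2 0 _ pl) theta_f1
    (modz_addn hkj _) (modz_subn hj' _) sq_f1 Nd (or_introl leg)); lia.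
- apply: (overpart_mod_eq0 pl (prime_ndvd_pow2 0 _ pl) theta_f2
    (modz_addn hkj _) (modz_subn hj' _) sq_f2 Nd (or_introl leg)); lia.
- apply: (overpart_mod_eq0 pl (prime_ndvd_pow2 1 _ pl) theta_f1_cube
    (modz_addn hkj _) (modz_subn hj' _) sq_tri Nd); [lia|lia|lia|].
  (* Here, as in the other cases allowing a zero residue, x_i is a literal factor of w_i. *)
  by case: leg => [|leg]; [left|right; split=> // i xi; exact: dvdz_mulr].
- apply: (overpart_mod_eq0 pl (prime_ndvd_pow2 1 _ pl) theta_f2_cube
    (modz_addn hkj _) (modz_subn hj' _) sq_2tri Nd); [lia|lia|lia|].
  by case: leg => [|leg]; [left|right; split=> // i xi; exact: dvdz_mulr].
- rewrite -[delta]mul1r -[_ * delta]addr0 in leg.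
  apply: (overpart_mod_eq0 pl (prime_ndvd_pow2 0 _ pl) theta_phi
    (modz_addn hkj _) (modz_subn hj' _) sq_phi Nd (or_introl leg)); lia.
- apply: (overpart_mod_eq0 pl (prime_ndvd_pow2 1 _ pl) theta_psi
    (modz_addn hkj _) (modz_subn hj' _) sq_tri Nd (or_introl leg)); lia.
- apply: (overpart_mod_eq0 pl (prime_ndvd_pow2 1 _ pl) theta_quintuple1
    (modz_addn hkj _) (modz_subn hj' _) sq_f1 Nd); [lia|lia|lia|].
  by case: leg => [|leg]; [left|right; split=> // i xi; exact: dvdz_mull].
- apply: (overpart_mod_eq0 pl (prime_ndvd_pow2 2 _ pl) theta_quintuple2
    (modz_addn hkj _) (modz_subn hj' _) sq_quintuple2 Nd); [lia|lia|lia|].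
  case: leg => [|leg]; [by left|right; split=> // i xi].
  by apply/dvdz_mull/dvdz_mulr.
Qed.
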